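(* Consider the detection problem with $m\ge2$ ($m$ fixed) Erdős–Rényi graphs with parameters $p,s$ possibly depending on $n$, as defined in the context. Suppose that $p=n^{-o(1)}$ and $p\le1-c$ for some fixed constant $c>0$. If, for some fixed $\epsilon>0$, $$(n-1)\,ps^2\ge(1+\epsilon)\frac{4\log n}{m\,\big(\log(1/p)-1+p\big)}\qquad\text{and}\qquad\sum_{r=3}^m s^{r-2}p^{-\binom{r-1}{2}}=o(1),$$ then strong detection is achievable.
   Context: Let $\mathcal{E}_n=\binom{[n]}{2}$ and $\mathfrak{S}_n$ the set of permutations of $[n]$, acting on $\mathcal{E}_n$ by $\tau(\{i,j\})=\{\tau(i),\tau(j)\}$. An alignment is an $m$-tuple $\pi=(\pi_1,\dots,\pi_m)$ of permutations with $\pi_1=\mathrm{Id}$. The observation $X=(X^1,\dots,X^m)$ consists of $m$ symmetric $\{0,1\}$-valued $n\times n$ matrices with zero diagonal. Under $H_1$ the observation has law $\mathsf{P}$: there is a uniformly distributed random alignment $\pi^\star$ and, conditioned on $\pi^\star$, $X^k_{\pi^\star_k(e)}=X^0_e\,\xi^k_e$ for $e\in\mathcal{E}_n$, $1\le k\le m$, where $X^0_e\sim\mathrm{Bern}(p)$ and $\xi^k_e\sim\mathrm{Bern}(s)$ are all mutually independent. Under $H_0$ the observation has law $\mathsf{Q}=\mathsf{P}_{X^1}\otimes\cdots\otimes\mathsf{P}_{X^m}$. A test statistic $T(X)$ with threshold $\tau$ (both may depend on $n$) achieves strong detection if $\mathsf{P}(T(X)<\tau)+\mathsf{Q}(T(X)\ge\tau)=o(1)$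 as $n\to\infty$; strong detection is achievable if some test achieves it. The notation $p=n^{-o(1)}$ means $\log(1/p)=o(\log n)$. The empty sum (case $m=2$) is $0$. *)

(* Defs.v *)
From mathcomp Require Import all_boot all_order all_algebra all_fingroup.
From mathcomp Require Import all_classical all_reals all_analysis.

Set Implicit Arguments.
Unset Strict Implicit.
Unset Printing Implicit Defensive.

Import Order.TTheory GRing.Theory Num.Theory.
Import numFieldNormedType.Exports.

Local Open Scope ring_scope.

(* Vertices are 'I_n and graphs are numbered by 'I_m, both starting from 0. *)

Definition edge (n : nat) := {e : {set 'I_n} | #|e| == 2}.

Lemma edge_act_subproof n (t : 'S_n) (e : edge n) : #|t @: val e| == 2.
Proof. by rewrite (card_imset _ (@perm_inj _ t)); exact: (valP e). Qed.

Definition edge_act n (t : 'S_n) (e : edge n) : edge n :=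
  exist _ (t @: val e) (edge_act_subproof t e).

Definition adjacency (n : nat) :=
  {A : 'M[bool]_n | (A^T == A) && [forall i, ~~ A i i]}.

Definition entry n (A : adjacency n) (e : edge n) : bool :=
  [exists i, exists j, (val e == [set i; j])%SET && (val A) i j].

Definition observation (m n : nat) := {ffun 'I_m -> adjacency n}.

Definition alignments (m n : nat) : {set {ffun 'I_m -> 'S_n}} :=
  [set pi : {ffun 'I_m -> 'S_n} |
    [forall k : 'I_m, (val k == 0%N) ==> (pi k == 1%g)]]%SET.

Definition observes m n (pi : {ffun 'I_m -> 'S_n}) (X0 : {ffun edge n -> bool})
    (xi : {ffun 'I_m * edge n -> bool}) (X : observation m n) : bool :=
  [forall k, forall e, entry (X k) (edge_act (pi k) e) == X0 e && xi (k, e)].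

Section Laws.
Variables (R : realType) (m n : nat) (p s : R).

(* The observation is determined by (pi, X0, xi), so this is the pushforward of
   the joint law of the latent variables. *)
Definition law1 (X : observation m n) : R :=
  \sum_(pi in alignments m n) \sum_(X0 : {ffun edge n -> bool})
    \sum_(xi : {ffun 'I_m * edge n -> bool} | observes pi X0 xi X)
      #|alignments m n|%:R^-1 * (\prod_e bernoulli_pmf p (X0 e))
        * (\prod_ke bernoulli_pmf s (xi ke)).

Definition marginal (mu : observation m n -> R) (k : 'I_m) (A : adjacency n)
  : R := \sum_(X : observation m n | X k == A) mu X.

Definition law0 (X : observation m n) : R :=
  \prod_(k < m) marginal law1 k (X k).

End Laws.

Definition prob (R : realType) (T : finType) (mu : T -> R) (E : pred T) : R :=
  \sum_(x | E x) mu x.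

Local Open Scope classical_set_scope.

Definition achieves_strong_detection (R : realType) (m : nat) (p s : nat -> R)
    (T : forall n, observation m n -> R) (tau : nat -> R) : Prop :=
  (fun n => prob (law1 (p n) (s n)) (fun X => T n X < tau n)
          + prob (law0 (p n) (s n)) (fun X => tau n <= T n X)) @ \oo --> (0 : R).

Definition strong_detection_achievable (R : realType) (m : nat)
    (p s : nat -> R) : Prop :=
  exists (T : forall n, observation m n -> R) (tau : nat -> R),
    achieves_strong_detection p s T tau.

(* p = n^{-o(1)}. Since ln 0 = 0 in the library, the positivity of p, which is
   implicit in log(1/p) = o(log n), has to be required separately. *)
Definition n_pow_minus_o1 (R : realType) (p : nat -> R) : Prop :=
  (\forall n \near \oo, 0 < p n) /\
  (fun n => ln (p n)^-1 : R^o) =o_\oo (fun n => ln n%:R : R^o).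

(* Main.v *)
Require Import Defs.
From mathcomp Require Import all_boot all_order all_algebra all_fingroup.
From mathcomp Require Import all_classical all_reals all_analysis.
From mathcomp Require Import ring lra.
Import Order.TTheory GRing.Theory Num.Theory.
Import numFieldNormedType.Exports.

Set Implicit Arguments.
Unset Strict Implicit.
Unset Printing Implicit Defensive.

Local Open Scope ring_scope.

(** The test scans over all alignments.  For an alignment pi, the score is
    sum_e C(S_e, 2), where S_e is the number of graphs that contain the edge e
    once they are relabelled by pi: it counts the edges that two aligned graphs
    share, over all pairs of graphs.  The statistic is the largest score, and
    the threshold is (1 - delta) mu with mu = C(n,2) C(m,2) p s^2, the mean
    score of the true alignment under H1.  Both error probabilities are
    bounded by Chernoff's method, because for a fixed alignment the S_e are
    independent over the edges under either law.

    Under H1 the statistic is at least the score of the true alignment, whose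
    edge terms take values in [0, C(m,2)].  The bound e^-x <= 1 - x + x^2 then
    makes the missed detection probability at most
    exp(- delta^2 mu / (4 C(m,2))) (law1_error).

    Under H0 each graph is Erdos-Renyi with edge probability ps
    (marginal_law1), so S_e is binomial with parameters m and ps.  The
    exponential tilt is chosen as L = log(1/p), so that a shared pair weighs
    1/p.  Relative to the term of r = 2, the term of index r in
    E p^-C(S_e,2) has order s^(r-2) p^-C(r-1,2); this is exactly what the
    second assumption makes negligible, whence
      E p^-C(S_e,2) <= 1 + C(m,2) p s^2 (1 - p + o(1))
    (independent_edge_mgf).  A union bound over the at most n^(n(m-1))
    alignments bounds the false alarm probability by the exponential of
      (m-1) n log n - mu (L - 1 + p - delta L - o(1))
    (law0_error), and the first assumption says precisely that
    mu (L - 1 + p) >= (1 + eps) (m-1) n log n (signal_ge).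

    The gap L - 1 + p is at least c^2/4 when p <= 1 - c (log_gap_ge).  It
    therefore dominates both a constant multiple of L and the o(1) term, which
    lets delta be a fixed constant.  Finally p = n^-o(1) gives
    L - 1 + p <= log n, hence mu >= n, and both errors decay exponentially
    in n. *)

(** * Graphs as edge indicators *)

Lemma edge_actK n (t : 'S_n) : cancel (edge_act t) (edge_act t^-1%g).
Proof.
move=> e; apply: val_inj => /=; rewrite -imset_comp -[RHS]imset_id.
by apply: eq_imset => i /=; rewrite permK.
Qed.

Lemma edge_actVK n (t : 'S_n) : cancel (edge_act t^-1%g) (edge_act t).
Proof. by move=> e; rewrite -{1}(invgK t) edge_actK. Qed.

Lemma edge_act_bij n (t : 'S_n) : bijective (edge_act t).
Proof. by exists (edge_act t^-1%g); [exact: edge_actK | exact: edge_actVK]. Qed.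

Lemma card_edge n : #|{: edge n}| = 'C(n, 2).
Proof. by rewrite card_sig -[in RHS](card_ord n) -card_draws cardsE. Qed.

(** The two endpoints in the definition of an entry are unordered, but a graph
    has a symmetric matrix, so any enumeration of the edge gives the same bit. *)
Lemma entryE n (A : adjacency n) (e : edge n) (i j : 'I_n) :
  val e = [set i; j]%SET -> entry A e = val A i j.
Proof.
move=> eij; apply/existsP/idP => [[i' /existsP[j' /andP[/eqP]]]|Aij]; last first.
  by exists i; apply/existsP; exists j; rewrite eij eqxx.
have /andP[/eqP Asym _] := valP A.
have symA a b : val A a b = val A b a by rewrite -[in LHS]Asym mxE.
rewrite eij => /setP eq_ij Aij'.
have := eq_ij i'; have := eq_ij j'; have := eq_ij i; have := eq_ij j.
rewrite !inE !eqxx !orbT /=.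
have /negPf ij : i' != j'.
  by apply/eqP => E; have /andP[_ /forallP/(_ i')] := valP A; rewrite {2}E Aij'.
move=> /esym/orP[/eqP ji'|/eqP jj'] /esym/orP[/eqP ii'|/eqP ij'].
- by rewrite ji' ii' orbb eq_sym ij.
- by rewrite ij' ji' symA.
- by rewrite ii' jj'.
- by rewrite ij' jj' orbb ij.
Qed.

Lemma edge_of_neq n (i j : 'I_n) :
  i != j -> exists e : edge n, val e = [set i; j]%SET.
Proof.
move=> ij; have c2 : #|[set i; j]%SET| == 2 by rewrite cards2 ij.
by exists (exist (fun e : {set 'I_n} => #|e| == 2) _ c2).
Qed.

Lemma entry_inj n (A B : adjacency n) : entry A =1 entry B -> A = B.
Proof.
move=> AB; apply: val_inj; apply/matrixP => i j.
have [->|/edge_of_neq[e eij]] := eqVneq i j; last first.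
  by rewrite -!(entryE _ eij).
have /andP[_ /forallP/(_ j)/negPf ->] := valP A.
by have /andP[_ /forallP/(_ j)/negPf ->] := valP B.
Qed.

Lemma graph_of_subproof n (x : edge n -> bool) :
  let A := \matrix_(i, j) [exists e : edge n, (val e == [set i; j]%SET) && x e] in
  (A^T == A) && [forall i, ~~ A i i].
Proof.
apply/andP; split; first by apply/eqP/matrixP => i j; rewrite !mxE finset.setUC.
apply/forallP => i; rewrite mxE; apply/existsP => -[e /andP[/eqP ei _]].
by have := valP e; rewrite ei finset.setUid cards1.
Qed.

(** The inverse of [entry]: graphs are the same as arbitrary edge indicators,
    which is what turns sums over graphs into sums over product spaces. *)
Definition graph_of n (x : edge n -> bool) : adjacency n :=
  exist _ (\matrix_(i, j) _) (graph_of_subproof x).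

Lemma entry_graph_of n (x : edge n -> bool) : entry (graph_of x) =1 x.
Proof.
move=> e; have : #|val e| == 2 := valP e.
move=> /cards2P[i [j [_ eij]]].
rewrite (entryE _ eij) mxE; apply/existsP/idP => [[e' /andP[]]|xe].
  by rewrite -eij => /eqP/val_inj ->.
by exists e; rewrite eij eqxx.
Qed.

(** * The law under H1 as an image of the latent variables *)

Section LatentVariables.
Variables (m n : nat).
Implicit Types (pi : {ffun 'I_m -> 'S_n}) (X : observation m n).
Implicit Types (base : {ffun edge n -> bool}).
Implicit Types (xi : {ffun 'I_m * edge n -> bool}).

Definition observed pi base xi : observation m n :=
  [ffun k => graph_of (fun e => let e' := edge_act (pi k)^-1%g e in
                                base e' && xi (k, e'))].

Lemma entry_observed pi base xi k e :
  entry (observed pi base xi k) (edge_act (pi k) e) = base e && xi (k, e).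
Proof. by rewrite ffunE entry_graph_of edge_actK. Qed.

(** The latent variables determine the observation, so sums over the relation
    [observes] collapse and the law under H1 is an image measure. *)
Lemma observesE pi base xi X : observes pi base xi X = (X == observed pi base xi).
Proof.
apply/forallP/eqP => [obsX|-> k]; last first.
  by apply/forallP => e; rewrite entry_observed.
apply/ffunP => k; apply: entry_inj => e.
rewrite -(edge_actVK (pi k) e) entry_observed.
by move: (edge_act (pi k)^-1%g e) => e'; have /forallP/(_ e')/eqP := obsX k.
Qed.

(** When the base graph is complete, the observation is a relabelling of the
    subsampling bits.  For a fixed alignment this bijection regroups the bits
    of an observation by aligned edge. *)
Lemma bij_observed_complete pi :
  bijective (fun Y : {ffun edge n -> {ffun 'I_m -> bool}} =>
    observed pi [ffun=> true] [ffun ke => Y ke.2 ke.1]).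
Proof.
exists (fun X => [ffun e => [ffun k => entry (X k) (edge_act (pi k) e)]]).
  by move=> Y; apply/ffunP => e; apply/ffunP => k;
    rewrite !ffunE entry_graph_of /= !ffunE edge_actK.
move=> X; apply/eqP; rewrite eq_sym -observesE; apply/forallP => k.
by apply/forallP => e; rewrite !ffunE.
Qed.

Lemma bij_uncurry :
  bijective (fun Y : {ffun edge n -> {ffun 'I_m -> bool}} =>
    [ffun ke : 'I_m * edge n => Y ke.2 ke.1]).
Proof.
exists (fun xi => [ffun e => [ffun k => xi (k, e)]]).
  by move=> Y; apply/ffunP => e; apply/ffunP => k; rewrite !ffunE.
by move=> xi; apply/ffunP => -[k e]; rewrite !ffunE.
Qed.

Variables (R : realType).
Implicit Types (p s q : R).

(** The latent bits are independent over edges, so the expectation of a product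
    of functions of the bits of single edges is a product of expectations. *)
Lemma latent_factor p s (g : edge n -> bool -> {ffun 'I_m -> bool} -> R) :
  \sum_(base : {ffun edge n -> bool}) \sum_(xi : {ffun 'I_m * edge n -> bool})
     (\prod_e bernoulli_pmf p (base e))
     * (\prod_ke bernoulli_pmf s (xi ke)) * \prod_e g e (base e) [ffun k => xi (k, e)]
  = \prod_e \sum_x bernoulli_pmf p x *
      \sum_(y : {ffun 'I_m -> bool}) (\prod_k bernoulli_pmf s (y k)) * g e x y.
Proof.
rewrite bigA_distr_bigA /=; apply: eq_bigr => base _.
rewrite big_split /= bigA_distr_bigA /= mulr_sumr.
rewrite (reindex _ (onW_bij _ bij_uncurry)) /=; apply: eq_bigr => Y _.
rewrite -mulrA; congr (_ * _); rewrite big_split /=; congr (_ * _); last first.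
  apply: eq_bigr => e _; congr (g _ _ _).
  by apply/ffunP => k; rewrite !ffunE.
rewrite exchange_big /= pair_bigA /=; apply: eq_bigr => -[k e] _.
by rewrite ffunE.
Qed.

Lemma law1_expectation p s (f : observation m n -> R) :
  \sum_X law1 p s X * f X
  = #|alignments m n|%:R^-1 * \sum_(pi in alignments m n)
      \sum_(base : {ffun edge n -> bool}) \sum_(xi : {ffun 'I_m * edge n -> bool})
      (\prod_e bernoulli_pmf p (base e)) * (\prod_ke bernoulli_pmf s (xi ke))
      * f (observed pi base xi).
Proof.
under eq_bigr do rewrite mulr_suml.
rewrite exchange_big /= mulr_sumr; apply: eq_bigr => pi _.
under eq_bigr do rewrite mulr_suml.
rewrite exchange_big /= mulr_sumr; apply: eq_bigr => base _.
under eq_bigr do rewrite mulr_suml.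
rewrite (exchange_big_dep xpredT) //= mulr_sumr; apply: eq_bigr => xi _.
by under eq_bigl do rewrite observesE; rewrite big_pred1_eq !mulrA.
Qed.

End LatentVariables.

(** * Independent Bernoulli bits *)

Lemma prob_indicator (R : realType) (T : finType) (mu : T -> R) (E : pred T) :
  prob mu E = \sum_x mu x * (E x)%:R.
Proof.
rewrite /prob big_mkcond /=; apply: eq_bigr => x _.
by case: (E x); rewrite ?mulr1 ?mulr0.
Qed.

Lemma prob_ge0 (R : realType) (T : finType) (mu : T -> R) (E : pred T) :
  (forall x, 0 <= mu x) -> 0 <= prob mu E.
Proof. by move=> mu0; apply: sumr_ge0. Qed.

Lemma bernoulli_prod_ge0 (R : realType) (I : finType) (q : R) (f : I -> bool) :
  0 <= q <= 1 -> 0 <= \prod_i bernoulli_pmf q (f i).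
Proof. by move=> q01; apply: prodr_ge0 => i _; exact: bernoulli_pmf_ge0. Qed.

Section BernoulliSubsets.
Variables (R : realType) (m : nat).
Implicit Types (q : R) (y : {ffun 'I_m -> bool}).

Lemma sum_bernoulli_pmf q (h : bool -> R) :
  \sum_b bernoulli_pmf q b * h b = q * h true + (1 - q) * h false.
Proof. by rewrite big_bool. Qed.

Lemma bernoulli_coordinate q (k : 'I_m) (h : bool -> R) :
  \sum_(y : {ffun 'I_m -> bool}) (\prod_l bernoulli_pmf q (y l)) * h (y k)
  = \sum_b bernoulli_pmf q b * h b.
Proof.
pose F l b := bernoulli_pmf q b * (if l == k then h b else 1).
transitivity (\sum_(y : {ffun 'I_m -> bool}) \prod_l F l (y l)).
  apply: eq_bigr => y _; rewrite big_split /=; congr (_ * _).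
  by rewrite -big_mkcond /= big_pred1_eq.
rewrite -bigA_distr_bigA /= (bigD1 k) //= [X in _ * X]big1 ?mulr1.
  by rewrite /F eqxx.
move=> l /negPf lk; rewrite /F lk sum_bernoulli_pmf; ring.
Qed.

(** The number of successes is binomial: subsets of equal size have equal
    weight. *)
Lemma bernoulli_count q (f : nat -> R) :
  \sum_(y : {ffun 'I_m -> bool}) (\prod_k bernoulli_pmf q (y k)) * f #|[pred k | y k]|
  = \sum_(r < m.+1) q ^+ r * (1 - q) ^+ (m - r) * f r *+ 'C(m, r).
Proof.
have bij_set : bijective
    (fun A : {set 'I_m} => [ffun k => k \in A] : {ffun 'I_m -> bool}).
  exists (fun y => [set k | y k]%SET).
    by move=> A; apply/setP => k; rewrite inE ffunE.
  by move=> y; apply/ffunP => k; rewrite ffunE inE.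
rewrite (reindex _ (onW_bij _ bij_set)) /=.
have cardA (A : {set 'I_m}) : (#|A| < m.+1)%N.
  by rewrite ltnS -[m in leqRHS]card_ord max_card.
rewrite (partition_big (fun A : {set 'I_m} => Ordinal (cardA A)) predT) //=.
apply: eq_bigr => r _.
rewrite -[X in 'C(X, r)](card_ord m) -card_draws -sumr_const.
apply: eq_big => [A|A /eqP rA]; first by rewrite inE.
have {rA} rA : #|A| = r by rewrite -[r in RHS]rA.
have -> : #|[pred k | [ffun k => k \in A] k]| = r.
  by rewrite -rA; apply: eq_card => k; rewrite inE ffunE.
congr (_ * _); rewrite (bigID [pred k | k \in A]) /=; congr (_ * _).
  rewrite -rA -prodr_const; apply: eq_bigr => k kA.
  by rewrite ffunE kA.
have <- : #|~: A| = (m - r)%N by rewrite cardsCs finset.setCK card_ord rA.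
rewrite -prodr_const; apply: eq_big => [k|k /negPf kA]; first by rewrite inE.
by rewrite ffunE kA.
Qed.

End BernoulliSubsets.

(** * The law under H0 *)

Section Marginal.
Variables (R : realType) (m n : nat) (p s : R).

Lemma card_alignments_gt0 : (0 < #|alignments m n|)%N.
Proof.
apply/card_gt0P; exists [ffun=> 1%g]; rewrite inE; apply/forallP => k.
by rewrite ffunE eqxx implybT.
Qed.

Lemma alignments_average (x : R) :
  #|alignments m n|%:R^-1 * \sum_(pi in alignments m n) x = x.
Proof.
rewrite sumr_const -[x *+ _]mulr_natl mulrA mulVf ?mul1r //.
by rewrite pnatr_eq0 -lt0n card_alignments_gt0.
Qed.

Lemma prod_bool (I : finType) (B : pred I) :
  \prod_i (B i)%:R = ([forall i, B i])%:R :> R.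
Proof.
case: forallP => [Ball|/forallP]; first by rewrite big1 // => i _; rewrite Ball.
by rewrite negb_forall => /existsP[i /negPf Bi]; rewrite (bigD1 i) //= Bi mul0r.
Qed.

(** Each edge of a single observed graph is kept with probability ps,
    independently of the others.  This law is invariant under relabelling, so
    averaging over the random alignment does not change it. *)
Lemma marginal_law1 (k : 'I_m) (A : adjacency n) :
  marginal (law1 p s) k A = \prod_e bernoulli_pmf (p * s) (entry A e).
Proof.
rewrite -[LHS]/(prob (law1 p s) (fun X : observation m n => X k == A)).
rewrite prob_indicator (law1_expectation p s (fun X => (X k == A)%:R)).
rewrite -[RHS]alignments_average; congr (_ * _); apply: eq_bigr => pi _.
rewrite (reindex _ (onW_bij _ (edge_act_bij (pi k)))) /=.
pose g e (x : bool) (y : {ffun 'I_m -> bool}) : R :=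
  (entry A (edge_act (pi k) e) == x && y k)%:R.
transitivity (\sum_(base : {ffun edge n -> bool})
    \sum_(xi : {ffun 'I_m * edge n -> bool}) (\prod_e bernoulli_pmf p (base e))
     * (\prod_ke bernoulli_pmf s (xi ke)) * \prod_e g e (base e) [ffun k => xi (k, e)]).
  apply: eq_bigr => base _; apply: eq_bigr => xi _; congr (_ * _).
  rewrite prod_bool; congr ((nat_of_bool _)%:R).
  apply/eqP/forallP => [<- e|obsA]; first by rewrite entry_observed ffunE.
  apply: entry_inj => e; rewrite -(edge_actVK (pi k) e) entry_observed.
  by have /eqP -> := obsA (edge_act (pi k)^-1%g e); rewrite ffunE.
rewrite latent_factor; apply: eq_bigr => e _; rewrite /g.
set a := entry _ _.
transitivity (\sum_x bernoulli_pmf p x *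
  \sum_b bernoulli_pmf s b * (a == x && b)%:R).
  apply: eq_bigr => x _.
  by rewrite (bernoulli_coordinate s k (fun b => (a == x && b)%:R)).
rewrite !sum_bernoulli_pmf /= /bernoulli_pmf.
by case: a => /=; ring.
Qed.

(** The alignment disappears from the right-hand side: independent Erdos-Renyi
    graphs look the same under every alignment, which is why a union bound over
    alignments only costs their number. *)
Lemma law0_expectation (pi : {ffun 'I_m -> 'S_n}) (h : {ffun 'I_m -> bool} -> R) :
  \sum_(X : observation m n) law0 p s X
     * \prod_e h [ffun k => entry (X k) (edge_act (pi k) e)]
  = (\sum_(y : {ffun 'I_m -> bool}) (\prod_k bernoulli_pmf (p * s) (y k)) * h y)
    ^+ 'C(n, 2).
Proof.
rewrite -card_edge -prodr_const bigA_distr_bigA /=.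
rewrite (reindex _ (onW_bij _ (bij_observed_complete pi))) /=.
apply: eq_bigr => Y _; rewrite [RHS]big_split /=; congr (_ * _).
  rewrite exchange_big /=; apply: eq_bigr => k _; rewrite marginal_law1.
  rewrite (reindex _ (onW_bij _ (edge_act_bij (pi k)))) /=.
  by apply: eq_bigr => e _; rewrite entry_observed !ffunE.
apply: eq_bigr => e _; congr h; apply/ffunP => k.
by rewrite ffunE entry_observed !ffunE.
Qed.

End Marginal.

(** * Exponential moments of the contribution of one edge *)

(** Choosing a set and then a pair inside it amounts to choosing the pair
    first. *)
Lemma mul_bin_pairs k r :
  ('C(k.+2, r.+2) * 'C(r.+2, 2) = 'C(k.+2, 2) * 'C(k, r))%N.
Proof.
have twice_pairs a : (2 * 'C(a.+2, 2) = a.+2 * a.+1)%N.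
  by rewrite -mul_bin_diag /= bin1.
have := mul_bin_diag k.+2 r.+1; have := mul_bin_diag k.+1 r.
rewrite /=; have := twice_pairs k; have := twice_pairs r.
move: 'C(k.+2, 2) 'C(k.+2, r.+2) 'C(r.+2, 2) 'C(k, r) 'C(k.+1, r.+1).
move=> a b c d e Er Ek E1 E2; apply/eqP; rewrite -(eqn_pmul2l (isT : 0 < 2)%N).
apply/eqP; transitivity (b * (r.+2 * r.+1))%N; first by rewrite -Er mulnCA.
transitivity (k.+2 * k.+1 * d)%N; last by rewrite -Ek mulnA.
by rewrite mulnA [(b * _)%N]mulnC -E2 -mulnA [(e * _)%N]mulnC -E1 mulnA.
Qed.

Lemma bin_le_pow2 k r : ('C(k, r) <= 2 ^ k)%N.
Proof.
rewrite -[k in 'C(k, _)](card_ord k) -card_draws.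
by rewrite -[k in leqRHS]card_ord -cardsT -card_powerset powersetT cardsT max_card.
Qed.

Section EdgeMoments.
Variables (R : realType) (m : nat).
Implicit Types (p s q L lam : R).

Lemma binomial_total q :
  \sum_(r < m.+1) q ^+ r * (1 - q) ^+ (m - r) *+ 'C(m, r) = 1.
Proof.
transitivity ((1 - q + q) ^+ m); last by rewrite subrK expr1n.
by rewrite exprDn; apply: eq_bigr => r _; rewrite mulrC.
Qed.

Lemma binomial_pairs_mean q :
  \sum_(r < m.+1) q ^+ r * (1 - q) ^+ (m - r) * 'C(r, 2)%:R *+ 'C(m, r)
  = 'C(m, 2)%:R * q ^+ 2.
Proof.
case: m => [|[|k]]; rewrite 2?big_ord_recl ?big_ord0 /= ?mulr0 ?mul0rn ?addr0 ?mul0r //.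
rewrite !add0r.
transitivity ('C(k.+2, 2)%:R * q ^+ 2 * (1 - q + q) ^+ k); last first.
  by rewrite subrK expr1n mulr1.
rewrite exprDn mulr_sumr. apply: eq_bigr => r _; rewrite /bump /= !add1n !subSS.
have -> : q ^+ r.+2 = q ^+ 2 * q ^+ r by rewrite -exprD.
have E : ('C(k.+2, r.+2) * 'C(r.+2, 2) = 'C(k.+2, 2) * 'C(k, r))%N.
  exact: mul_bin_pairs.
rewrite -mulr_natr -[in RHS]mulr_natr.
have E' := congr1 (fun z => z%:R : R) E; rewrite !natrM in E'.
ring: E'.
Qed.

Lemma expRN_le_quadratic (x : R) : 0 <= x -> expR (- x) <= 1 - x + x ^+ 2.
Proof.
move=> x0; rewrite expRN -div1r ler_pdivrMr ?expR_gt0 //.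
have q0 : 0 <= 1 - x + x ^+ 2 by nra.
apply: le_trans (ler_wpM2l q0 (expR_ge1Dx x)).
have : 0 <= x ^+ 3 by rewrite exprn_ge0.
nra.
Qed.

(** The quadratic remainder of the exponential is absorbed in the linear term,
    since C(r,2)^2 <= C(m,2) C(r,2). *)
Lemma present_edge_mgf s lam : 0 <= s <= 1 -> 0 <= lam ->
  \sum_(r < m.+1) s ^+ r * (1 - s) ^+ (m - r) * expR (- (lam * 'C(r, 2)%:R))
      *+ 'C(m, r)
  <= 1 - lam * (1 - lam * 'C(m, 2)%:R) * ('C(m, 2)%:R * s ^+ 2).
Proof.
move=> /andP[s0 s1] lam0; have s'0 : 0 <= 1 - s by rewrite subr_ge0.
set K := lam * _.
have -> : 1 - K * ('C(m, 2)%:R * s ^+ 2) = \sum_(r < m.+1)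
    s ^+ r * (1 - s) ^+ (m - r) * (1 - K * 'C(r, 2)%:R) *+ 'C(m, r).
  rewrite -binomial_pairs_mean -[X in X - _](binomial_total s) mulr_sumr -sumrB.
  apply: eq_bigr => r _; rewrite mulrnAr -mulrnBl; congr (_ *+ _); ring.
apply: ler_sum => r _; rewrite lerMn2r; apply/orP; right.
apply: ler_wpM2l; first by rewrite mulr_ge0 ?exprn_ge0.
rewrite /K; set a : R := 'C(r, 2)%:R; set M : R := 'C(m, 2)%:R.
have a0 : 0 <= a by [].
have aM : a <= M by rewrite ler_nat leq_bin2l // -ltnS.
have la0 : 0 <= lam * a by rewrite mulr_ge0.
apply: le_trans (expRN_le_quadratic la0) _.
have : 0 <= lam ^+ 2 * a * (M - a) by rewrite !mulr_ge0 ?exprn_ge0 ?subr_ge0.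
nra.
Qed.

(** Under H1 and the true alignment an edge contributes only if it is in the
    base graph, which is the extra factor p compared to [present_edge_mgf]. *)
Lemma correlated_edge_mgf p s lam : 0 <= p <= 1 -> 0 <= s <= 1 -> 0 <= lam ->
  \sum_x bernoulli_pmf p x * \sum_(y : {ffun 'I_m -> bool})
    (\prod_k bernoulli_pmf s (y k))
      * expR (- (lam * 'C(#|[pred k | x && y k]|, 2)%:R))
  <= expR (- (lam * (1 - lam * 'C(m, 2)%:R) * ('C(m, 2)%:R * (p * s ^+ 2)))).
Proof.
move=> /andP[p0 p1] s01 lam0; apply: le_trans (expR_ge1Dx _).
rewrite (sum_bernoulli_pmf p (fun x => \sum_(y : {ffun 'I_m -> bool})
  (\prod_k bernoulli_pmf s (y k))
      * expR (- (lam * 'C(#|[pred k | x && y k]|, 2)%:R)))) /=.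
rewrite (bernoulli_count _ s (fun r => expR (- (lam * 'C(r, 2)%:R)))).
under [X in _ + (1 - p) * X]eq_bigr do rewrite eq_card0 // mulr0 oppr0 expR0.
rewrite (bernoulli_count _ s (fun=> 1)).
under [X in _ + (1 - p) * X]eq_bigr do rewrite mulr1.
rewrite binomial_total.
have := ler_wpM2l p0 (present_edge_mgf s01 lam0); lra.
Qed.

(** The tilt 1/p per shared pair balances the p^2 of two independent copies of
    an edge against the p of a common one: the pair term r = 2 becomes
    C(m,2) p s^2 (1 - p).  For r >= 3 the weight (ps)^r p^-C(r,2) equals
    p s^2 s^(r-2) p^-C(r-1,2), because C(r,2) = C(r-1,2) + (r-1). *)
Lemma independent_edge_mgf p s : (2 <= m)%N -> 0 < p <= 1 -> 0 <= s <= 1 ->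
  \sum_(r < m.+1) (p * s) ^+ r * (1 - p * s) ^+ (m - r) * p ^- 'C(r, 2)
      *+ 'C(m, r)
  <= 1 + 'C(m, 2)%:R * (p * s ^+ 2)
     * (1 - p + (2 ^ m)%:R * \sum_(3 <= r < m.+1) s ^+ (r - 2) * p ^- 'C(r.-1, 2)).
Proof.
move=> m2 /andP[p0 p1] /andP[s0 s1].
have ps0 : 0 <= p * s by rewrite mulr_ge0 // ltW.
have ps1 : 0 <= 1 - p * s by rewrite subr_ge0 mulr_ile1 // ltW.
have ps1' : 1 - p * s <= 1 by rewrite gerBl.
rewrite -lerBlDl -[X in _ - X](binomial_total (p * s)) -sumrB.
rewrite (eq_bigr (fun r : 'I_m.+1 => (p * s) ^+ r * (1 - p * s) ^+ (m - r)
   * (p ^- 'C(r, 2) - 1) * 'C(m, r)%:R)); last first.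
  by move=> r _; rewrite -mulrnBl mulr_natr mulrBr mulr1.
rewrite -(big_mkord xpredT (fun r => (p * s) ^+ r * (1 - p * s) ^+ (m - r)
   * (p ^- 'C(r, 2) - 1) * 'C(m, r)%:R)).
(* The terms r = 0 and r = 1 vanish: no pair of graphs shares the edge. *)
rewrite big_ltn // big_ltn ?ltnS 1?ltnW // big_ltn //=.
rewrite (@bin_small 0 2) // (@bin_small 1 2) // binn !expr0 !expr1 invr1 subrr.
rewrite !mulr0 !mul0r !add0r [leRHS]mulrDr; apply: lerD.
  rewrite exprMn -subr_ge0.
  have -> : p ^+ 2 * s ^+ 2 * (1 - p * s) ^+ (m - 2) * (p^-1 - 1) * 'C(m, 2)%:R
    = 'C(m, 2)%:R * (p * s ^+ 2) * (1 - p) * (1 - p * s) ^+ (m - 2).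
    by field; rewrite gt_eqF.
  rewrite subr_ge0 ler_piMr ?exprn_ile1 //.
  by rewrite !mulr_ge0 ?exprn_ge0 ?subr_ge0 // ltW.
rewrite !mulr_sumr big_nat_cond [leRHS]big_nat_cond; apply: ler_sum => r.
rewrite andbT => /andP[r3 rm].
have r0 : (0 < r)%N by apply: leq_trans r3.
have p_unit k : p ^+ k != 0 by rewrite expf_neq0 ?gt_eqF.
have -> : (p * s) ^+ r * (1 - p * s) ^+ (m - r) * (p ^- 'C(r, 2) - 1) * 'C(m, r)%:R
  = p * s ^+ 2 * (s ^+ (r - 2) * p ^+ r.-1)
    * ((1 - p * s) ^+ (m - r) * (p ^- 'C(r, 2) - 1)) * 'C(m, r)%:R.
  have -> : (p * s) ^+ r = p * p ^+ r.-1 * (s ^+ 2 * s ^+ (r - 2)).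
    by rewrite -exprS -exprD prednK // subnKC ?exprMn // ltnW.
  ring.
have binr : 'C(r, 2) = ('C(r.-1, 2) + r.-1)%N by rewrite -{1}(prednK r0) binS bin1.
have weight_le : (1 - p * s) ^+ (m - r) * (p ^- 'C(r, 2) - 1) <= p ^- 'C(r, 2).
  have v1 : 1 <= p ^- 'C(r, 2).
    by rewrite invf_ge1 ?exprn_gt0 // exprn_ile1 // ltW.
  apply: le_trans (_ : p ^- 'C(r, 2) - 1 <= _); last by rewrite gerBl.
  by rewrite ler_piMl ?subr_ge0 // exprn_ile1.
have -> : 'C(m, 2)%:R * (p * s ^+ 2) * ((2 ^ m)%:R * (s ^+ (r - 2) / p ^+ 'C(r.-1, 2)))
  = p * s ^+ 2 * (s ^+ (r - 2) * p ^+ r.-1) * p ^- 'C(r, 2)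
    * ('C(m, 2) * 2 ^ m)%:R.
  by rewrite binr exprD natrM; field; rewrite !p_unit.
apply: ler_pM; rewrite ?ler0n //.
- rewrite !mulr_ge0 ?exprn_ge0 ?(ltW p0) //.
  by rewrite subr_ge0 invf_ge1 ?exprn_gt0 // exprn_ile1 // ltW.
- by apply: ler_wpM2l weight_le; rewrite !mulr_ge0 ?exprn_ge0 ?(ltW p0).
- rewrite ler_nat (leq_trans (bin_le_pow2 m r)) // leq_pmull //.
  by rewrite bin_gt0.
Qed.

End EdgeMoments.

(** * Tail bounds for the scan statistic *)

(** The first permutation is the identity, so an alignment is determined by the
    other m - 1.  Against the m (m - 1) / 2 pairs of graphs in the mean score,
    this count gives the factor 4 / m of the assumption on n p s^2. *)
Lemma card_alignments_le m n : (#|alignments m n| <= n ^ (n * m.-1))%N.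
Proof.
have fact_le a : (a`! <= a ^ a)%N.
  elim: a => // a IH; rewrite factS expnS leq_mul2l /=.
  by apply: leq_trans IH _; case: a => // a; rewrite leq_exp2r.
case: m => [|m].
  rewrite muln0 expn0; apply: leq_trans (max_card _) _.
  by rewrite card_ffun card_ord.
rewrite /= expnM; apply: leq_trans (_ : n`! ^ m <= _)%N; last first.
  by case: m => // m; rewrite leq_exp2r.
have <- : #|{ffun 'I_m -> 'S_n}| = (n`! ^ m)%N by rewrite card_ffun card_ord card_Sn.
pose tail (pi : {ffun 'I_m.+1 -> 'S_n}) := [ffun k : 'I_m => pi (lift ord0 k)].
rewrite -(card_in_imset (f := tail)); first exact: max_card.
move=> pi pi'; rewrite !inE => /forallP/(_ ord0)/eqP pi0 /forallP/(_ ord0)/eqP pi'0.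
move=> /ffunP eq_tail; apply/ffunP => k; case: (unliftP ord0 k) => [j|] ->.
  by have := eq_tail j; rewrite !ffunE.
by rewrite pi0 pi'0.
Qed.

Section ScanTest.
Variables (m n : nat).
Implicit Types (pi : {ffun 'I_m -> 'S_n}) (X : observation m n).

Definition score pi X : nat :=
  \sum_e 'C(#|[pred k | entry (X k) (edge_act (pi k) e)]|, 2).

Definition max_score X : nat := \max_(pi in alignments m n) score pi X.

Variables (R : realType) (p s : R).
Hypotheses (p01 : 0 <= p <= 1) (s01 : 0 <= s <= 1).

Lemma expR_score (lam : R) pi X :
  expR (lam * (score pi X)%:R)
  = \prod_e expR (lam * 'C(#|[pred k | entry (X k) (edge_act (pi k) e)]|, 2)%:R).
Proof. by rewrite -expR_sum -mulr_sumr /score natr_sum. Qed.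

Lemma law0_ge0 X : 0 <= law0 p s X.
Proof.
apply: prodr_ge0 => k _; rewrite marginal_law1; apply: bernoulli_prod_ge0.
move: p01 s01 => /andP[p0 p1] /andP[s0 s1].
by rewrite mulr_ge0 //= mulr_ile1.
Qed.

(** Markov's inequality for exp(L score), after a union bound over the
    alignments. *)
Lemma law0_max_score_tail (L t : R) : 0 <= L ->
  prob (law0 p s) (fun X => t <= (max_score X)%:R)
  <= #|alignments m n|%:R * (expR (- (L * t)) *
      (\sum_(r < m.+1) (p * s) ^+ r * (1 - p * s) ^+ (m - r)
         * expR (L * 'C(r, 2)%:R) *+ 'C(m, r)) ^+ 'C(n, 2)).
Proof.
move=> L0; rewrite prob_indicator.
apply: (@le_trans _ _ (\sum_X law0 p s X * \sum_(pi in alignments m n)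
   expR (- (L * t)) * expR (L * (score pi X)%:R))).
  apply: ler_sum => X _; apply: ler_wpM2l; first exact: law0_ge0.
  have sum_ge0 : 0 <= \sum_(pi in alignments m n)
     expR (- (L * t)) * expR (L * (score pi X)%:R).
    by apply: sumr_ge0 => pi _; rewrite mulr_ge0 ?expR_ge0.
  case t_le: (t <= (max_score X)%:R) => //=.
  have [pi pi_al max_pi] := eq_bigmax_cond (score ^~ X) (card_alignments_gt0 m n).
  rewrite (bigD1 pi) //= -[leLHS]addr0; apply: lerD; last first.
    by apply: sumr_ge0 => pi' _; rewrite mulr_ge0 ?expR_ge0.
  rewrite -expRD -[leLHS]expR0 ler_expR addrC -mulrBr mulr_ge0 // subr_ge0.
  by rewrite -max_pi.
under eq_bigr do rewrite mulr_sumr.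
rewrite exchange_big /= mulr_natl -sumr_const; apply: ler_sum => pi _.
rewrite -(bernoulli_count _ _ (fun r => expR (L * 'C(r, 2)%:R))).
rewrite -(law0_expectation p s pi) mulr_sumr; apply: ler_sum => X _.
rewrite mulrCA expR_score le_eqVlt; apply/orP; left; apply/eqP.
congr (_ * (_ * _)); apply: eq_bigr => e _; congr (expR (_ * 'C(_, 2)%:R)).
by apply: eq_card => k; rewrite !inE ffunE.
Qed.

(** The maximum dominates the score of the alignment that generated the data,
    so Markov's inequality is applied to exp(- lam score) conditionally on this
    alignment; its edge terms depend only on the latent bits. *)
Lemma law1_max_score_tail (lam t : R) : 0 <= lam ->
  prob (law1 p s) (fun X => (max_score X)%:R < t)
  <= expR (lam * t) * (\sum_x bernoulli_pmf p x * \sum_(y : {ffun 'I_m -> bool})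
    (\prod_k bernoulli_pmf s (y k))
      * expR (- (lam * 'C(#|[pred k | x && y k]|, 2)%:R))) ^+ 'C(n, 2).
Proof.
move=> lam0; rewrite prob_indicator (law1_expectation p s).
set mgf := (X in expR _ * X); rewrite -[leRHS](alignments_average m n).
apply: ler_wpM2l; first by rewrite invr_ge0.
apply: ler_sum => pi pi_al.
rewrite /mgf -card_edge -prodr_const.
rewrite -(latent_factor p s (fun _ x y =>
   expR (- (lam * 'C(#|[pred k | x && y k]|, 2)%:R)))).
rewrite mulr_sumr; apply: ler_sum => base _.
rewrite mulr_sumr; apply: ler_sum => xi _.
rewrite mulrCA; apply: ler_wpM2l.
  by rewrite mulr_ge0 ?bernoulli_prod_ge0.
have -> : \prod_e expR (- (lam *
      'C(#|[pred k | base e && [ffun k => xi (k, e)] k]|, 2)%:R))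
   = expR (- (lam * (score pi (observed pi base xi))%:R)) :> R.
  rewrite -mulNr expR_score; apply: eq_bigr => e _.
  rewrite mulNr; congr (expR (- (_ * 'C(_, 2)%:R))); apply: eq_card => k.
  by rewrite !inE ffunE entry_observed.
rewrite -expRD -mulrBr; case lt_t: ((max_score _)%:R < t) => /=; last exact: expR_ge0.
rewrite -[leLHS]expR0 ler_expR mulr_ge0 // subr_ge0; apply: ltW; apply: le_lt_trans lt_t.
by rewrite ler_nat /max_score (bigD1 pi) //= leq_maxl.
Qed.

End ScanTest.

Lemma law1_ge0 (R : realType) (m n : nat) (p s : R) (X : observation m n) :
  0 <= p <= 1 -> 0 <= s <= 1 -> 0 <= law1 p s X.
Proof.
move=> p01 s01; do 3![apply: sumr_ge0 => ? _].
by rewrite !mulr_ge0 ?invr_ge0 ?bernoulli_prod_ge0.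
Qed.

(** * The two error probabilities *)

Definition mean_score (R : realType) (m n : nat) (p s : R) : R :=
  'C(n, 2)%:R * ('C(m, 2)%:R * (p * s ^+ 2)).

(** The relative entropy of a Poisson law of mean a with respect to one of mean
    pa, divided by a; it is the exponential cost, per unit of mean score, for
    uncorrelated graphs to look correlated. *)
Definition log_gap (R : realType) (p : R) : R := ln p^-1 - 1 + p.

(** The relative weight, in the exponential moment under H0, of the edges
    shared by at least three graphs. *)
Definition overlap_sum (R : realType) (m : nat) (p s : R) : R :=
  \sum_(3 <= r < m.+1) s ^+ (r - 2) * p ^- 'C(r.-1, 2).

Section Thresholds.
Variables (R : realType) (m n : nat) (p s delta : R).
Hypotheses (m2 : (2 <= m)%N) (p01 : 0 < p <= 1) (s01 : 0 <= s <= 1).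

Let p0 : 0 < p. Proof. by case/andP: p01. Qed.
Let p1 : p <= 1. Proof. by case/andP: p01. Qed.
Let p01' : 0 <= p <= 1. Proof. by rewrite (ltW p0) p1. Qed.
Let pairs_gt0 : 0 < 'C(m, 2)%:R :> R. Proof. by rewrite ltr0n bin_gt0. Qed.

Lemma law1_error : 0 < delta ->
  prob (law1 p s) (fun X : observation m n =>
    (max_score X)%:R < (1 - delta) * mean_score m n p s)
  <= expR (- (delta ^+ 2 / (4 * 'C(m, 2)%:R) * mean_score m n p s)).
Proof.
(* This tilt minimises lam^2 C(m,2) - lam delta. *)
move=> delta0; pose lam := delta / (2 * 'C(m, 2)%:R).
have lam0 : 0 <= lam by rewrite divr_ge0 ?mulr_ge0 // ltW.
apply: le_trans (law1_max_score_tail m n p01' s01 _ lam0) _.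
set mgf := \sum_x _.
have mgf_ge0 : 0 <= mgf.
  apply: sumr_ge0 => x _; rewrite mulr_ge0 ?bernoulli_pmf_ge0 //.
  by apply: sumr_ge0 => y _; rewrite mulr_ge0 ?expR_ge0 ?bernoulli_prod_ge0.
have mgf_le := correlated_edge_mgf m p01' s01 lam0.
have {mgf_le} := lerXn2r 'C(n, 2) mgf_ge0 (expR_ge0 _) mgf_le.
rewrite -expRM_natl => mgf_le.
apply: le_trans (ler_wpM2l (expR_ge0 _) mgf_le) _.
rewrite -expRD ler_expR le_eqVlt; apply/orP; left; apply/eqP.
by rewrite /lam /mean_score; field; rewrite gt_eqF.
Qed.

(** With the tilt L = log(1/p), the union bound pays (m-1) n log n, the
    threshold earns (1 - delta) L mu, and the exponential moment of the score
    costs at most (1 - p + o(1)) mu. *)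
Lemma law0_error : (0 < n)%N ->
  prob (law0 p s) (fun X : observation m n =>
    (1 - delta) * mean_score m n p s <= (max_score X)%:R)
  <= expR ((n * m.-1)%:R * ln n%:R - mean_score m n p s *
      (log_gap p - delta * ln p^-1 - (2 ^ m)%:R * overlap_sum m p s)).
Proof.
move=> n0; have L0 : 0 <= ln p^-1 by rewrite ln_ge0 // invf_ge1.
apply: le_trans (law0_max_score_tail m n p01' s01 _ L0) _.
set mgf := \sum_(r < _) _.
have mgf_le : mgf <= expR ('C(m, 2)%:R * (p * s ^+ 2)
     * (1 - p + (2 ^ m)%:R * overlap_sum m p s)).
  apply: le_trans (expR_ge1Dx _).
  apply: le_trans (independent_edge_mgf m2 p01 s01).
  rewrite le_eqVlt; apply/orP; left; apply/eqP; apply: eq_bigr => r _.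
  by rewrite expRM_natr lnK ?posrE ?invr_gt0 // exprVn.
have mgf_ge0 : 0 <= mgf.
  have /andP[s0 s1] := s01.
  apply: sumr_ge0 => r _; rewrite mulrn_wge0 // mulr_ge0 ?expR_ge0 //.
  by rewrite mulr_ge0 // exprn_ge0 ?subr_ge0 ?mulr_ge0 ?mulr_ile1 // ltW.
have {mgf_le} := lerXn2r 'C(n, 2) mgf_ge0 (expR_ge0 _) mgf_le.
rewrite -expRM_natl => mgf_le.
have card_le : #|alignments m n|%:R <= expR ((n * m.-1)%:R * ln n%:R) :> R.
  by rewrite expRM_natl lnK ?posrE ?ltr0n // -natrX ler_nat card_alignments_le.
rewrite expRD; apply: ler_pM card_le _; rewrite ?mulr_ge0 ?expR_ge0 ?exprn_ge0 //.
apply: le_trans (ler_wpM2l (expR_ge0 _) mgf_le) _.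
rewrite -expRD ler_expR le_eqVlt; apply/orP; left; apply/eqP.
by rewrite /mean_score /log_gap; ring.
Qed.

End Thresholds.

(** * Consequences of the assumptions for large n *)

Section Estimates.
Variable R : realType.
Implicit Types (p c eps : R).

(** With q = sqrt p, the bound ln q <= q - 1 gives L - 1 + p >= (1 - q)^2,
    and 1 - q >= (1 - p) / 2 >= c / 2. *)
Lemma log_gap_ge p c : 0 < p -> 0 < c -> p <= 1 - c -> c ^+ 2 / 4 <= log_gap p.
Proof.
move=> p0 c0 pc; pose q := Num.sqrt p.
have q0 : 0 < q by rewrite sqrtr_gt0.
have pq : p = q * q by rewrite -expr2 sqr_sqrtr // ltW.
have lnq : ln q <= q - 1.
  by have := @le_ln1Dx R (q - 1); rewrite addrCA subrr addr0; apply; lra.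
have lnp : ln p^-1 = - (ln q + ln q) by rewrite lnV ?posrE // pq lnM ?posrE.
rewrite /log_gap lnp.
have q1 : q < 1 by nra.
have : c <= (1 - q) * 2 by nra.
nra.
Qed.

(** L exceeds the gap by at most 1, which is at most 4/c^2 times the gap. *)
Lemma ln_inv_le_log_gap p c : 0 < p -> 0 < c -> p <= 1 - c ->
  ln p^-1 <= (1 + 4 / c ^+ 2) * log_gap p.
Proof.
move=> p0 c0 pc; have := log_gap_ge p0 c0 pc.
have c2 : 0 < c ^+ 2 / 4 by rewrite divr_gt0 ?exprn_gt0.
rewrite -(ler_pM2l (x := (c ^+ 2 / 4)^-1)) ?invr_gt0 //.
rewrite mulVf ?gt_eqF // invf_div /log_gap mulrDl mul1r; lra.
Qed.

Lemma bin2R n : 'C(n, 2)%:R = n%:R * (n%:R - 1) / 2 :> R.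
Proof.
case: n => [|n]; first by rewrite !mul0r.
have := mul_bin_diag n.+1 1; rewrite /= bin1 => /(congr1 (fun k => k%:R : R)).
by rewrite !natrM -natr1; lra.
Qed.

(** The assumption on n p s^2, multiplied by n(m-1) m (L - 1 + p) / 4: the mean
    score has n(n-1)/2 edges times m(m-1)/2 pairs of graphs. *)
Lemma signal_ge m n p s eps : (2 <= m)%N -> 0 < log_gap p ->
  (n%:R - 1) * p * s ^+ 2 >=
    (1 + eps) * (4 * ln n%:R / (m%:R * log_gap p)) ->
  (1 + eps) * ((n * m.-1)%:R * ln n%:R) <= mean_score m n p s * log_gap p.
Proof.
move=> m2 D0; have mR : m%:R = m.-1%:R + 1 :> R by rewrite natr1 prednK // ltnW.
have m0 : 0 < m%:R :> R by rewrite ltr0n ltnW.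
rewrite mulrA ler_pdivrMr ?mulr_gt0 // => signal.
rewrite /mean_score !bin2R natrM.
have -> : n%:R * (n%:R - 1) / 2 * (m%:R * (m%:R - 1) / 2 * (p * s ^+ 2)) * log_gap p
  = n%:R * m.-1%:R * ((n%:R - 1) * p * s ^+ 2 * (m%:R * log_gap p)) / 4.
  by rewrite mR; field.
have nm0 : 0 <= n%:R * m.-1%:R :> R by rewrite -natrM.
have := ler_wpM2l nm0 signal; lra.
Qed.

End Estimates.

(** Half of the margin eps pays for lowering the threshold and for the edges
    shared by three graphs or more: each costs a fraction e1 of the gap D, and
    (1 + eps)(1 - 2 e1) = 1 + eps / 2. *)
Lemma error_exponent_le (R : realType) (B D L O Z delta eps e1 mu : R) :
  0 < eps -> e1 = eps / (4 * (1 + eps)) -> 0 <= mu ->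
  delta * L <= e1 * D -> Z * O <= e1 * D -> (1 + eps) * B <= mu * D ->
  B - mu * (D - delta * L - Z * O) <= - (eps / 2 * B).
Proof.
move=> eps0 e1E mu0 dL ZO signal.
have e1_le : (1 - 2 * e1) * (1 + eps) = 1 + eps / 2.
  by rewrite e1E; field; rewrite gt_eqF // addr_gt0.
have e1_ge0 : 0 <= 1 - 2 * e1 by nra.
have : mu * (D * (1 - 2 * e1)) <= mu * (D - delta * L - Z * O).
  by apply: ler_wpM2l => //; lra.
have := ler_wpM2l e1_ge0 signal.
by rewrite [X in X <= _ -> _]mulrA e1_le; lra.
Qed.

Local Open Scope classical_set_scope.
Local Open Scope ring_scope.

Theorem theorem7p1 (R : realType) (m : nat) (p s : nat -> R) (c eps : R)
  (hm : (2 <= m)%N)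
  (hp01 : forall n, 0 <= p n <= 1)
  (hs01 : forall n, 0 <= s n <= 1)
  (hp : n_pow_minus_o1 p)
  (hc : 0 < c)
  (hpc : \forall n \near \oo, p n <= 1 - c)
  (heps : 0 < eps)
  (hnps : \forall n \near \oo,
    (n%:R - 1) * p n * s n ^+ 2 >=
      (1 + eps) * (4 * ln n%:R / (m%:R * (ln (p n)^-1 - 1 + p n))))
  (hsum : (fun n => \sum_(3 <= r < m.+1) s n ^+ (r - 2) * p n ^- 'C(r.-1, 2))
    @ \oo --> (0 : R)) :
  strong_detection_achievable m p s.
Proof.
case: hp => p_gt0 /eqoP/(_ 1 ltr01) ln_p_le.
pose e1 : R := eps / (4 * (1 + eps)).
have e1_gt0 : 0 < e1 by rewrite divr_gt0 ?mulr_gt0 // addr_gt0.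
(* Chosen so that delta L <= e1 (L - 1 + p) by ln_inv_le_log_gap. *)
pose gap_const : R := 1 + 4 / c ^+ 2.
have gap_const_gt0 : 0 < gap_const by rewrite addr_gt0 // divr_gt0 ?exprn_gt0.
pose delta := e1 / gap_const.
have delta_gt0 : 0 < delta by rewrite divr_gt0.
have pow_gt0 : 0 < (2 ^ m)%:R :> R by rewrite ltr0n expn_gt0.
have threshold_gt0 : 0 < e1 * (c ^+ 2 / 4) / (2 ^ m)%:R.
  by rewrite divr_gt0 // mulr_gt0 // divr_gt0 ?exprn_gt0.
have overlap_small := cvgr_lt _ hsum _ threshold_gt0.
pose rate1 : R := delta ^+ 2 / (4 * 'C(m, 2)%:R).
have rate1_gt0 : 0 < rate1.
  by rewrite divr_gt0 ?exprn_gt0 // mulr_gt0 // ltr0n bin_gt0.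
pose rate0 : R := eps / 2 * ln 2.
have rate0_gt0 : 0 < rate0 by rewrite mulr_gt0 ?divr_gt0 // ln_gt0 // ltr1n.
exists (fun n X => (max_score X)%:R).
exists (fun n => (1 - delta) * mean_score m n (p n) (s n)).
apply: (squeeze_cvgr (f := fun=> 0)
  (h := fun n => expR (- rate1) ^+ n + expR (- rate0) ^+ n)); last first.
- have geometric (x : R) : 0 < x -> (fun n => expR (- x) ^+ n) @ \oo --> (0 : R).
    move=> x0; apply: cvg_expr.
    by rewrite ger0_norm ?expR_ge0 // expR_lt1 oppr_lt0.
  by rewrite -[X in _ --> X]addr0; apply: cvgD; exact: geometric.
- exact: cvg_cst.
near=> n.
have n2 : (2 <= n)%N by near: n; exists 2%N.
have n0 : (0 < n)%N by apply: leq_trans n2.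
have pn0 : 0 < p n by near: n.
have pn01 : 0 < p n <= 1 by rewrite pn0; case/andP: (hp01 n).
have pnc : p n <= 1 - c by near: n.
have signal : (n%:R - 1) * p n * s n ^+ 2 >=
  (1 + eps) * (4 * ln n%:R / (m%:R * (ln (p n)^-1 - 1 + p n))) by near: n.
have ln_n_gt0 : 0 < ln n%:R :> R by rewrite ln_gt0 // ltr1n.
have inv_p_le : ln (p n)^-1 <= ln n%:R.
  have : `|ln (p n)^-1| <= 1 * `|ln n%:R : R| by near: n.
  by rewrite mul1r [`|ln n%:R|]gtr0_norm //; apply: le_trans; exact: ler_norm.
have overlap_le : overlap_sum m (p n) (s n) < e1 * (c ^+ 2 / 4) / (2 ^ m)%:R.
  by rewrite /overlap_sum; near: n; exact: overlap_small.
have gap_ge := log_gap_ge pn0 hc pnc.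
have gap_gt0 : 0 < log_gap (p n).
  by apply: lt_le_trans gap_ge; rewrite divr_gt0 ?exprn_gt0.
have {}signal := signal_ge hm gap_gt0 signal.
have mean0 : 0 <= mean_score m n (p n) (s n).
  by rewrite /mean_score !mulr_ge0 ?exprn_ge0 ?(ltW pn0) //; case/andP: (hs01 n).
have nm_ge : n%:R <= (n * m.-1)%:R :> R.
  by rewrite ler_nat leq_pmulr // -ltnS prednK // ltnW.
have mean_ge : n%:R <= mean_score m n (p n) (s n).
  rewrite -(ler_pM2r ln_n_gt0).
  have gap_le : log_gap (p n) <= ln n%:R.
    by apply: le_trans inv_p_le; rewrite /log_gap; case/andP: pn01; lra.
  apply: le_trans (ler_wpM2l mean0 gap_le); apply: le_trans signal.
  have := ler_wpM2r (ltW ln_n_gt0) nm_ge.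
  have : 0 <= eps * ((n * m.-1)%:R * ln n%:R).
    by rewrite !mulr_ge0 ?(ltW heps) ?(ltW ln_n_gt0).
  lra.
have prob1_ge0 := prob_ge0 (fun X : observation m n =>
   (max_score X)%:R < (1 - delta) * mean_score m n (p n) (s n))
   (fun X => law1_ge0 X (hp01 n) (hs01 n)).
have prob0_ge0 := prob_ge0 (fun X : observation m n =>
   (1 - delta) * mean_score m n (p n) (s n) <= (max_score X)%:R)
   (fun X => law0_ge0 (hp01 n) (hs01 n) X).
rewrite addr_ge0 //=; apply: lerD.
- apply: le_trans (law1_error n hm pn01 (hs01 n) delta_gt0) _.
  by rewrite -expRM_natl ler_expR mulrN lerN2 mulrC ler_pM2l.
- apply: le_trans (law0_error delta hm pn01 (hs01 n) n0) _.
  rewrite -expRM_natl ler_expR.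
  apply: le_trans (error_exponent_le heps erefl mean0 _ _ signal) _.
  + rewrite /delta -/e1 mulrAC ler_pdivrMr // -[leRHS]mulrA ler_pM2l // mulrC.
    exact: ln_inv_le_log_gap.
  + rewrite -/e1 -ler_pdivlMl //; apply: le_trans (ltW overlap_le) _.
    by rewrite mulrC ler_pM2l ?invr_gt0 // ler_pM2l.
  + rewrite mulrN lerN2 /rate0 mulrCA ler_pM2l ?divr_gt0 //.
    apply: ler_pM nm_ge _; rewrite ?ln_ge0 ?ler1n //.
    by rewrite ler_ln ?posrE ?ltr0n // ler_nat.
Unshelve. all: by end_near.
Qed.
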